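(* There are absolute constants $c_0>0$ and $C$ such that the following holds. Let $(X,\Pi)$ be a $d$-dimensional $\gamma$-$q$-eposet with $\gamma\le q^{-c_0k^2}$, $k<d$, and let $f\in C_k$ have HD-Level-Set Decomposition $f=f_0+\dots+f_k$. Let $c$ denote a quantity with $c\le q^{Ck^2}$. If $f$ is $(\varepsilon_1,\dots,\varepsilon_\ell)$-$\ell_\infty$-pseudorandom, then for all $1\le i\le\ell$, \[|\langle f,f_i\rangle|\le\Big(\binom{k}{i}_q+c\gamma\Big)\varepsilon_i^2+c\gamma\|f\|^2.\] If $f$ is $(\varepsilon_1,\dots,\varepsilon_\ell)$-$\ell_\infty$-pseudorandom and additionally has $i$-local constant sign, or if $f$ is $(\varepsilon_1,\dots,\varepsilon_\ell)$-$\ell_2$-pseudorandom, then \[|\langle f,f_i\rangle|\le\binom{k}{i}_q\varepsilon_i|\mathbb E[f]|+c\gamma\|f\|^2.\]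
   Context: $\binom{m}{t}_q=\frac{(1-q^m)\cdots(1-q^{m-t+1})}{(1-q^t)\cdots(1-q)}$ is the Gaussian binomial coefficient. A weighted pure $q$-simplicial complex is given by $X(d)\subseteq G_q(n,d)$ (the $d$-dimensional subspaces of $\mathbb F_q^n$) with a probability distribution $\pi_d$ on $X(d)$; $X(i)$ is the set of $i$-dimensional subspaces contained in some element of $X(d)$, ordered by inclusion, and $\pi_i(V)=\binom{d}{i}_q^{-1}\sum_{W\in X(d),W\supseteq V}\pi_d(W)$. $C_i$ = real functions on $X(i)$ with $\langle f,g\rangle=\sum_V\pi_i(V)f(V)g(V)$, $\|f\|=\langle f,f\rangle^{1/2}$, $\mathbb E[f]=\sum_V\pi_i(V)f(V)$, and $\mathrm{Var}(g)=\langle g,g\rangle-\mathbb E[g]^2$. Up operator $U_if(W)=\binom{i+1}{i}_q^{-1}\sum_{V\subset W,\dim V=i}f(V)$; down operator $D_{i+1}f(V)=\frac{\sum_{W\supset V,W\in X(i+1)}\pi_{i+1}(W)f(W)}{\sum_{W\supset V,W\in X(i+1)}\pi_{i+1}(W)}$; $U^k_i=U_{k-1}\cdots U_i$, $D^k_i=D_{i+1}\cdots D_k$. The complex is a $\gamma$-$q$-eposet if $\|D_{i+1}U_i-(1-\delta_i)I-\delta_iU_{i-1}D_i\|\le\gamma$ for $1\le i\le d-1$ with $\delta_i=q\frac{q^i-1}{q^{i+1}-1}$. HD-Level-Set Decomposition: $H^0=C_0$, $H^i=\ker D_i$, $V^i_k=U^k_iH^i$; for small $\gamma$, $C_k=\bigoplus_iV^i_k$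 and $f=\sum f_i$ with $f_i\in V^i_k$. $f$ is $(\varepsilon_1,\dots,\varepsilon_\ell)$-$\ell_\infty$-pseudorandom if $\|D^k_if-\mathbb E[f]\|_\infty\le\varepsilon_i$ ($1\le i\le\ell$), and $\ell_2$-pseudorandom if $\mathrm{Var}(D^k_if)\le\varepsilon_i|\mathbb E[f]|$ ($1\le i\le\ell$). For $s\in X(i)$ let $X_s=\{W\in X(k):W\supset s\}$ and $\mathbb E_{X_s}[f]$ the $\pi_k$-weighted average of $f$ over $X_s$; $f$ has $i$-local constant sign if $\mathbb E[f]\ne0$ and every nonzero $\mathbb E_{X_s}[f]$ ($s\in X(i)$) has the same sign as $\mathbb E[f]$. *)

(* Defs.v *)
From HB Require Import structures.
From mathcomp Require Import all_boot all_order all_algebra.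
From mathcomp Require Import classical_sets reals ereal exp.

Set Implicit Arguments.
Unset Strict Implicit.
Unset Printing Implicit Defensive.

Import Order.TTheory GRing.Theory Num.Theory.

Local Open Scope ring_scope.

(* The subspaces of a finite-dimensional space over a finite field form a
   finite type; vector.v only provides the choiceType structure. *)
Section FiniteSubspaces.
Variables (F : finFieldType) (vT : vectType F).
Import VectorInternalTheory.
HB.instance Definition _ := [Countable of {vspace vT} by <:].
HB.instance Definition _ := [Finite of {vspace vT} by <:].
End FiniteSubspaces.

Definition qbinom (R : realType) (q : R) (m t : nat) : R :=
  (\prod_(j < t) (1 - q ^+ (m - j))) / (\prod_(j < t) (1 - q ^+ (t - j))).

Record wqcomplex (R : realType) (F : finFieldType) (n d : nat) := WQComplex {
  facets : {set {vspace 'rV[F]_n}};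
  weight : {vspace 'rV[F]_n} -> R;
  facets_dim : forall W, W \in facets -> \dim W = d;
  weight_ge0 : forall W, W \in facets -> 0 <= weight W;
  weight_sum1 : \sum_(W in facets) weight W = 1
}.

Section WeightedQComplex.
Variables (R : realType) (F : finFieldType) (n d : nat).
Variable X : wqcomplex R F n d.

Local Notation S := {vspace 'rV[F]_n}.
Local Notation q := (#|F|%:R : R).

Definition faces (i : nat) : {set S} :=
  [set V : S | (\dim V == i) && [exists W in facets X, (V <= W)%VS]].

Definition pi_ (i : nat) (V : S) : R :=
  (qbinom q d i)^-1 * \sum_(W in facets X | (V <= W)%VS) weight X W.

(* An element of C_i is represented by a function on all subspaces. Only its
   values on [faces i] are meaningful, and all notions below depend on these
   values only. *)
Local Notation cochain := (S -> R).

Definition dotf (i : nat) (f g : cochain) : R :=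
  \sum_(V in faces i) pi_ i V * f V * g V.

Definition normf (i : nat) (f : cochain) : R := Num.sqrt (dotf i f f).

Definition expect (i : nat) (f : cochain) : R :=
  \sum_(V in faces i) pi_ i V * f V.

Definition variance (i : nat) (f : cochain) : R :=
  dotf i f f - expect i f ^+ 2.

Definition linfnorm (i : nat) (f : cochain) : R :=
  \big[Num.max/0]_(V in faces i) `|f V|.

(* Operator norm of A : C_i -> C_i, in the extended reals. *)
Definition opnorm (i : nat) (A : cochain -> cochain) : \bar R :=
  ereal_sup [set (normf i (A f))%:E | f in [set f | normf i f <= 1]]%classic.

(* [up i] is U_i : C_i -> C_(i+1). *)
Definition up (i : nat) (f : cochain) : cochain := fun W =>
  (qbinom q i.+1 i)^-1 * \sum_(V : S | (V <= W)%VS && (\dim V == i)) f V.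

(* [down i] is D_i : C_i -> C_(i-1). The quotient is 0 when V has weight 0. *)
Definition down (i : nat) (f : cochain) : cochain := fun V =>
  (\sum_(W in faces i | (V <= W)%VS) pi_ i W * f W) /
  (\sum_(W in faces i | (V <= W)%VS) pi_ i W).

(* U_(i+m-1) ... U_i *)
Fixpoint up_steps (i m : nat) (f : cochain) : cochain :=
  if m is m'.+1 then up (i + m') (up_steps i m' f) else f.

(* D_(i+1) ... D_(i+m) *)
Fixpoint down_steps (i m : nat) (f : cochain) : cochain :=
  if m is m'.+1 then down_steps i m' (down (i + m) f) else f.

(* U^k_i : C_i -> C_k and D^k_i : C_k -> C_i, for i <= k. *)
Definition upk (k i : nat) : cochain -> cochain := up_steps i (k - i).
Definition downk (k i : nat) : cochain -> cochain := down_steps i (k - i).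

Definition delta (i : nat) : R := q * ((q ^+ i - 1) / (q ^+ i.+1 - 1)).

Definition eposet (gamma : R) : Prop :=
  forall i : nat, (1 <= i < d)%N ->
    (opnorm i (fun f V => (down i.+1 (up i f) V - (1 - delta i) * f V
                           - delta i * up i.-1 (down i f) V)%R) <= gamma%:E)%E.

(* Membership in H^i. *)
Definition in_H (i : nat) (h : cochain) : Prop :=
  if i is i'.+1 then forall V, V \in faces i' -> down i h V = 0 else True.

(* Membership in V^i_k = U^k_i H^i. *)
Definition in_V (k i : nat) (g : cochain) : Prop :=
  exists2 h : cochain, in_H i h & forall W, W \in faces k -> g W = upk k i h W.

Definition level_set_decomposition (k : nat) (f : cochain)
    (fs : nat -> cochain) : Prop :=
  (forall i : nat, (i <= k)%N -> in_V k i (fs i)) /\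
  (forall W, W \in faces k -> f W = \sum_(i < k.+1) fs i W).

Definition linf_pseudorandom (k l : nat) (eps : nat -> R) (f : cochain) :=
  forall i : nat, (1 <= i <= l)%N ->
    linfnorm i (fun V => downk k i f V - expect k f) <= eps i.

Definition l2_pseudorandom (k l : nat) (eps : nat -> R) (f : cochain) :=
  forall i : nat, (1 <= i <= l)%N ->
    variance i (downk k i f) <= eps i * `|expect k f|.

(* E_(X_s)[f]; the quotient is 0 when s has weight 0. *)
Definition local_expect (k : nat) (s : S) (f : cochain) : R :=
  (\sum_(W in faces k | (s <= W)%VS) pi_ k W * f W) /
  (\sum_(W in faces k | (s <= W)%VS) pi_ k W).

Definition local_constant_sign (k i : nat) (f : cochain) : Prop :=
  expect k f != 0 /\
  forall s, s \in faces i -> local_expect k s f != 0 ->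
    Num.sg (local_expect k s f) = Num.sg (expect k f).

End WeightedQComplex.

(* Main.v *)
Require Import Defs.
From mathcomp Require Import all_boot all_order all_algebra all_field.
From mathcomp Require Import boolp reals ereal exp ring lra zify.

Set Implicit Arguments.
Unset Strict Implicit.
Unset Printing Implicit Defensive.

Import Order.TTheory GRing.Theory Num.Theory.
Local Open Scope ring_scope.

(* Write f_j = U^k_j h_j with h_j in H^j. The eposet inequality turns
   U^m_j h_j into an approximate eigenvector of D_(m+1) U_m with eigenvalue
   [m-j+1]_q / [m+1]_q; multiplying these eigenvalues, the Gram matrix of the
   f_j is diagonal up to an error of order gamma, with diagonal entries
   |h_j|^2 / binom(k,j)_q. On the other hand h_i is orthogonal to the
   constants for i > 0, so Cauchy-Schwarz gives
     <f, f_i>^2 = <D^k_i f - E[f], h_i>^2 <= Var(D^k_i f) |h_i|^2,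
   and |h_i|^2 is about binom(k,i)_q <f, f_i>. Hence |<f, f_i>| is at most
   binom(k,i)_q Var(D^k_i f) up to the error, and each pseudorandomness
   hypothesis bounds this variance. *)

(** * Gaussian integers and the counting of subspaces and flags *)

Section GaussianCounting.
Variables (R : realType) (F : finFieldType) (n : nat).
Local Notation S := {vspace 'rV[F]_n}.
Local Notation q := (#|F|%:R : R).

Definition qint (m : nat) : R := (q ^+ m - 1) / (q - 1).

Lemma q_gt1 : 1 < q.
Proof. by rewrite ltr1n finNzRing_gt1. Qed.

Lemma qX_gt1 m : 1 < q ^+ m.+1.
Proof. by rewrite exprn_egt1 // q_gt1. Qed.

Lemma qint_gt0 m : 0 < qint m.+1.
Proof. by rewrite divr_gt0 // subr_gt0 ?qX_gt1 ?q_gt1. Qed.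

Lemma qint1 : qint 1 = 1.
Proof. by rewrite /qint expr1 divff // subr_eq0 gt_eqF ?q_gt1. Qed.

Lemma qint_mulr m : qint m * (q - 1) = q ^+ m - 1.
Proof. by rewrite /qint mulfVK // subr_eq0 gt_eqF ?q_gt1. Qed.

Definition qfact (m : nat) : R := \prod_(j < m) qint j.+1.

Lemma qfactS m : qfact m.+1 = qfact m * qint m.+1.
Proof. by rewrite /qfact big_ord_recr. Qed.

Lemma qfact_gt0 m : 0 < qfact m.
Proof. by apply: prodr_gt0 => j _; apply: qint_gt0. Qed.

Lemma qfact_rev m : \prod_(j < m) qint (m - j) = qfact m.
Proof.
rewrite /qfact (reindex_inj rev_ord_inj) /=; apply: eq_bigr => j _.
by rewrite subKn.
Qed.

(** Each factor [1 - q ^+ a] is [-(q - 1)] times the Gaussian integer of [a]. Numerator and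
    denominator both have [t] factors, so the powers of [-(q - 1)] cancel. *)
Lemma qbinom_qfact m t : (t <= m)%N ->
  qbinom q m t = qfact m / (qfact t * qfact (m - t)).
Proof.
move=> le_tm.
have qsub a : 1 - q ^+ a = - (q - 1) * qint a.
  by rewrite mulNr mulrC qint_mulr opprB.
have -> : qbinom q m t = (\prod_(j < t) qint (m - j)) / qfact t.
  rewrite /qbinom -qfact_rev !(eq_bigr _ (fun j _ => qsub _)) !big_split /=.
  rewrite -mulf_div divff ?mul1r // prodr_const expf_neq0 // oppr_eq0 subr_eq0.
  by rewrite gt_eqF ?q_gt1.
have -> : qfact m = (\prod_(j < t) qint (m - j)) * qfact (m - t).
  rewrite -(qfact_rev m) -(big_mkord xpredT (fun j => qint (m - j))).
  rewrite (big_cat_nat (n := t)) //= big_mkord; congr (_ * _).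
  rewrite -{1}[t]add0n big_addn big_mkord -qfact_rev.
  by apply: eq_bigr => j _; rewrite subnDA subnAC.
have := qfact_gt0 t; have := qfact_gt0 (m - t).
by move: (qfact t) (qfact _) => a b b0 a0; field; rewrite !gt_eqF.
Qed.

Lemma qintS i : qint i.+1 = 1 + q * qint i.
Proof.
have q1 := q_gt1.
rewrite /qint exprS; move: (q ^+ _) => x.
by field; rewrite !subr_eq0 gt_eqF.
Qed.

Lemma qint_ge0 i : 0 <= qint i.
Proof. by case: i => [|i]; rewrite ?(ltW (qint_gt0 _)) //
/qint subrr mul0r. Qed.

Lemma qfact_ge1 i : 1 <= qfact i.
Proof.
elim: i => [|i IHi]; first by rewrite /qfact big_ord0.
rewrite qfactS qintS; apply: mulr_ege1 => //.
by rewrite lerDl mulr_ge0 ?qint_ge0.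
Qed.

Lemma qbinom_succ i : qbinom q i.+1 i = qint i.+1.
Proof.
rewrite qbinom_qfact // subSnn qfactS /qfact big_ord1 qint1 mulr1 mulrC.
rewrite mulKf //.
by rewrite gt_eqF ?qfact_gt0.
Qed.

Lemma qbinom_gt0 k i : (i <= k)%N -> 0 < qbinom q k i.
Proof.
by move=> ik; rewrite qbinom_qfact // divr_gt0 ?mulr_gt0 ?qfact_gt0.
Qed.

(** The factorials in the denominator are at least 1, and each of the [k] factors of the numerator
    satisfies [[j+1]_q <= q^(j+1) <= q^k], because [q - 1 >= 1]. *)
Lemma qbinom_le k i : (i <= k)%N -> qbinom q k i <= q ^+ (k ^ 2).
Proof.
move=> ik; rewrite qbinom_qfact // ler_pdivrMr ?mulr_gt0 ?qfact_gt0 //.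
have q1 := q_gt1; have q0 : 0 < q by apply: lt_trans q1.
apply: (@le_trans _ _ (q ^+ (k ^ 2))); last first.
  by rewrite ler_peMr ?exprn_ge0 ?(ltW q0) //; apply: mulr_ege1;
    apply: qfact_ge1.
have -> : q ^+ (k ^ 2) = \prod_(j < k) q ^+ k.
  by rewrite prodr_const card_ord -exprM mulnn.
apply: ler_prod => j _; rewrite qint_ge0 /=.
have jk : q ^+ j.+1 <= q ^+ k by rewrite ler_eXn2l.
have q2 : 2 <= q by rewrite ler_nat finNzRing_gt1.
have y0 : 0 <= q ^+ j.+1 by rewrite exprn_ge0 // ltW.
apply: le_trans jk; rewrite ler_pdivrMr ?subr_gt0 //; nra.
Qed.

(** The vectors of [T] outside [V] are counted in two ways: each such [x] lies in exactly one cover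
    of [V], namely [V + <[x]>], and every cover inside [T] contains [q^(dim V + 1) - q^(dim V)] of
    them. *)
Lemma card_covers (V T : S) :
  (V <= T)%VS ->
  \sum_(W : S | [&& (V <= W)%VS, (W <= T)%VS & \dim W == (\dim V).+1]) (1 : R)
  = qint (\dim T - \dim V).
Proof.
move=> sVT.
have q1 := q_gt1.
have q0 : 0 < q by apply: lt_trans q1.
pose PW (W : S) := [&& (V <= W)%VS, (W <= T)%VS & \dim W == (\dim V).+1].
have cardD (W : S) : (V <= W)%VS ->
    (#|[pred x | (x \in W) && (x \notin V)]|%:R : R)
    = q ^+ \dim W - q ^+ \dim V.
  move=> sVW; have := cardID (mem V) (mem W).
  have -> : #|[predI W & V]| = #|V|.
    by apply: eq_card => x; rewrite !inE andb_idl //; apply: (subvP sVW).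
  rewrite !card_vspace => /(congr1 (fun m => m%:R : R)).
  rewrite natrD !natrX => <-; rewrite [RHS]addrC addKr.
  by congr (_%:R); apply: eq_card => x; rewrite !inE andbC.
have dimVx (x : 'rV[F]_n) : x \notin V -> \dim (V + <[x]>) = (\dim V).+1.
  move=> xV; rewrite dimv_disjoint_sum ?dim_vline.
    by case: eqP xV => [->|_ _]; rewrite ?mem0v // addn1.
  apply/eqP; rewrite -subv0; apply/subvP => y; rewrite memv_cap memv0.
  case/andP=> yV /vlineP[a def_y]; rewrite def_y scaler_eq0.
  apply/orP; left; apply: contraNT xV => a0.
  by rewrite -[x]scale1r -(mulVf a0) -scalerA -def_y memvZ.
have part : (#|[pred x | (x \in T) && (x \notin V)]|%:R : R)
    = \sum_(W | PW W) (q ^+ (\dim V).+1 - q ^+ \dim V).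
  rewrite -sum1_card natr_sum.
  rewrite (partition_big (fun x => (V + <[x]>)%VS) PW) /=; last first.
    move=> x; rewrite inE => /andP[xT xV].
    by rewrite /PW addvSl subv_add sVT -memvE xT dimVx /=.
  apply: eq_bigr => W /and3P[sVW sWT /eqP dW].
  rewrite -dW -cardD // -sum1_card natr_sum; apply: eq_bigl => x; rewrite !inE.
  case xV: (x \in V); rewrite ?andbF //= !andbT.
  apply/andP/idP => [[_ /eqP <-]|xW].
    by rewrite memvE addvSr.
  rewrite (subvP sWT) //; split=> //.
  by rewrite eqEdim subv_add sVW -memvE xW /= dimVx ?xV // dW.
rewrite cardD // in part.
have qV : 0 < q ^+ \dim V by rewrite exprn_gt0.
have qT : q ^+ \dim T = q ^+ \dim V * q ^+ (\dim T - \dim V).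
  by rewrite -exprD subnKC // dimvS.
have sumE : \sum_(W | PW W) (q ^+ (\dim V).+1 - q ^+ \dim V)
    = (\sum_(W | PW W) 1) * (q ^+ \dim V * (q - 1)).
  rewrite mulr_suml; apply: eq_bigr => W _.
  by rewrite mul1r exprSr mulrBr mulr1.
move: part; rewrite sumE qT /qint => part.
have q10 : q - 1 != 0 by rewrite subr_eq0 gt_eqF.
apply: (mulIf (mulf_neq0 (lt0r_neq0 qV) q10)); rewrite -part.
by field.
Qed.

(* Up to normalisation, [flags s m] is [U^(i+m)_i] applied to the indicator
   of [s], where [i] is the dimension of [s]. *)
Fixpoint flags (s : S) (m : nat) (W : S) : R :=
  if m is m'.+1 then
    \sum_(V : S | (V <= W)%VS && (\dim V == \dim s + m')%N) flags s m' V
  else (W == s)%:R.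

(** Induction on [m]: after exchanging the sums, a flag ending at [V] extends inside [W] in as many
    ways as [V] has covers there, and [card_covers] counts these. *)
Lemma sum_flags (s W : S) m :
  \sum_(V : S | (V <= W)%VS && (\dim V == \dim s + m)%N) flags s m V
  = (s <= W)%VS%:R * \prod_(t < m) qint (\dim W - \dim s - t).
Proof.
elim: m => [|m IHm] /=.
  rewrite big_ord0 mulr1 addn0 /=.
  case: (boolP (s <= W)%VS) => sW.
    rewrite (bigD1 s) /= ?sW ?eqxx //= big1 ?addr0 // => V.
    case/andP=> _ nVs.
    by rewrite (negPf nVs).
  rewrite big1 // => V /andP[VW _]; case: eqP => // Vs.
  by rewrite -Vs VW in sW.
rewrite (exchange_big_dep
  (fun V => (V <= W)%VS && (\dim V == \dim s + m)%N)) /=.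
  rewrite big_ord_recr /= mulrA -IHm mulr_suml; apply: eq_bigr => V.
  case/andP=> sVW /eqP dV; rewrite -subnDA -dV -card_covers // mulr_sumr.
  apply: eq_big => [U|U _]; rewrite ?mulr1 // dV addnS eqxx andbT.
  by rewrite andbC; case: (V <= U)%VS.
by move=> U V /andP[UW _] /andP[VU ->]; rewrite (subv_trans VU UW).
Qed.

(** [sum_flags] supplies every factor of the factorial except the last one, which is [[1]_q = 1]. *)
Lemma flagsE (s W : S) m : \dim W = (\dim s + m)%N ->
  flags s m W = (s <= W)%VS%:R * qfact m.
Proof.
case: m => [|m] dW /=; first by
  rewrite /qfact big_ord0 mulr1 eq_sym eqEdim dW addn0 leqnn andbT.
rewrite sum_flags dW addKn -(qfact_rev m.+1) big_ord_recr /= subSnn qint1.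
by rewrite mulr1.
Qed.

(** The complete flags from 0 to [W] are sorted by their hyperplane: [[m+1]_q!] is [[m]_q!] times
    the number of hyperplanes. *)
Lemma card_hyperplanes (W : S) m : \dim W = m.+1 ->
  \sum_(V : S | (V <= W)%VS && (\dim V == m)) (1 : R) = qint m.+1.
Proof.
move=> dW; apply: (mulIf (lt0r_neq0 (qfact_gt0 m))).
rewrite [RHS]mulrC -qfactS mulr_suml.
have := @flagsE 0%VS W m.+1; rewrite sub0v mul1r dimv0 add0n => <- //=.
rewrite dimv0 add0n; apply: eq_bigr => V /andP[_ /eqP dV].
by rewrite flagsE ?dimv0 // sub0v.
Qed.

End GaussianCounting.

Lemma weighted_cauchy_schwarz (R : realType) (I : finType) (P : pred I)
    (w f g : I -> R) : (forall i, P i -> 0 <= w i) ->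
  (\sum_(i | P i) w i * f i * g i) ^+ 2
  <= (\sum_(i | P i) w i * f i * f i) * (\sum_(i | P i) w i * g i * g i).
Proof.
move=> w0; set A := \sum_(i | _) w i * f i * f i.
set B := \sum_(i | _) _; set C := \sum_(i | _) _.
have form s t : 0 <= s ^+ 2 * A - 2 * s * t * B + t ^+ 2 * C.
  have -> : s ^+ 2 * A - 2 * s * t * B + t ^+ 2 * C
      = \sum_(i | P i) w i * (s * f i - t * g i) ^+ 2.
    rewrite !mulr_sumr -sumrB -big_split /=; apply: eq_bigr => i _; ring.
  by apply: sumr_ge0 => i Pi; rewrite mulr_ge0 ?w0 ?sqr_ge0.
have C0 : 0 <= C.
  by apply: sumr_ge0 => i Pi; rewrite -mulrA mulr_ge0 ?w0 // -expr2 sqr_ge0.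
have A0 : 0 <= A.
  by apply: sumr_ge0 => i Pi; rewrite -mulrA mulr_ge0 ?w0 // -expr2 sqr_ge0.
have [Cgt0|] := ltP 0 C.
  have := form C B.
  have -> : C ^+ 2 * A - 2 * C * B * B + B ^+ 2 * C = C * (A * C - B ^+ 2).
    by ring.
  by rewrite pmulr_rge0 // subr_ge0.
move=> Cle0; have -> : C = 0 by apply/eqP; rewrite eq_le Cle0 C0.
(* For [C = 0] the form at [(B, A + 1)] equals [-(A + 2) B^2], which forces [B = 0]. *)
rewrite mulr0; have := form B (A + 1).
have -> : C = 0 by apply/eqP; rewrite eq_le Cle0 C0.
have := sqr_ge0 B; nra.
Qed.

(** * Weights, the up and down operators, and their adjointness *)

Section Operators.
Variables (R : realType) (F : finFieldType) (n d : nat).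
Variable X : wqcomplex R F n d.
Local Notation S := {vspace 'rV[F]_n}.
Local Notation q := (#|F|%:R : R).
Local Notation qint := (qint R F).
Local Notation qfact := (qfact R F).
Local Notation pi_ := (pi_ X).
Local Notation dot := (dotf X).
Local Notation norm := (normf X).
Local Notation down := (Defs.down X).
Implicit Types (f g h u v : S -> R) (V W : S).

Lemma pi_ge0 i V : (i <= d)%N -> 0 <= pi_ i V.
Proof.
move=> id; rewrite mulr_ge0 //.
  by rewrite invr_ge0 qbinom_qfact // ltW // divr_gt0 ?mulr_gt0 ?qfact_gt0.
by apply: sumr_ge0 => W /andP[WX _]; apply: weight_ge0.
Qed.

Lemma pi_nonface i V : \dim V = i -> V \notin faces X i -> pi_ i V = 0.
Proof.
move=> dV; rewrite inE dV eqxx /= negb_exists => /forallP nV.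
rewrite /Defs.pi_ big1 ?mulr0 // => W /andP[WX VW].
by have := nV W; rewrite WX VW.
Qed.

(** Subspaces of dimension [i] that are not faces have weight 0. Passing to sums over all subspaces
    makes the counting lemmas applicable. *)
Lemma sum_faces i (P : pred S) (f : S -> R) :
  \sum_(V in faces X i | P V) pi_ i V * f V
  = \sum_(V | (\dim V == i) && P V) pi_ i V * f V.
Proof.
rewrite [RHS](bigID (mem (faces X i))) /= [X in _ + X]big1 ?addr0; last first.
  by move=> V /andP[/andP[/eqP dV _]] VX; rewrite pi_nonface ?mul0r.
apply: eq_bigl => V; rewrite !inE; case: (\dim V == i) => //=.
by rewrite andbC.
Qed.

(** Exchanging the sums, each facet above [V] is met once for each of the [[d-i]_q] covers of [V]
    inside it; the ratio of the two Gaussian binomials turns [[d-i]_q] into [[i+1]_q]. *)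
Lemma sum_cofaces i V : (i < d)%N -> \dim V = i ->
  \sum_(W | (\dim W == i.+1) && (V <= W)%VS) pi_ i.+1 W = qint i.+1 * pi_ i V.
Proof.
move=> id dV; rewrite /Defs.pi_ -mulr_sumr.
rewrite (exchange_big_dep (fun T => (T \in facets X) && (V <= T)%VS)) /=;
  last first.
  by move=> W T /andP[_ VW] /andP[-> WT]; rewrite (subv_trans VW WT).
have -> : \sum_(T in facets X | (V <= T)%VS)
    \sum_(W | (\dim W == i.+1) && (V <= W)%VS &&
              ((T \in facets X) && (W <= T)%VS)) weight X T
    = \sum_(T in facets X | (V <= T)%VS) qint (d - i) * weight X T.
  apply: eq_bigr => T /andP[TX VT].
  have cVT := card_covers R VT.
  rewrite (facets_dim TX) dV in cVT; rewrite -cVT mulr_suml.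
  apply: eq_big => [W|W _]; rewrite ?mul1r // TX /=.
  by case: (V <= W)%VS; case: (W <= T)%VS; rewrite ?andbT ?andbF.
rewrite -mulr_sumr [LHS]mulrA [RHS]mulrA; congr (_ * _).
rewrite !qbinom_qfact ?(ltnW id) // qfactS -(subnSK id) (qfactS _ _ (d - i.+1)).
have := qfact_gt0 R F d; have := qfact_gt0 R F i.
have := qfact_gt0 R F (d - i.+1); have := qint_gt0 R F i.
have := qint_gt0 R F (d - i.+1).
move: (qfact d) (qfact i) (qfact _) (qint i.+1) (qint _) => a b c x y *.
by field; rewrite !gt_eqF.
Qed.

Lemma pi_coface_eq0 i V W : (i < d)%N -> \dim V = i -> \dim W = i.+1 ->
  (V <= W)%VS -> pi_ i V = 0 -> pi_ i.+1 W = 0.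
Proof.
move=> id dV dW VW pV; have := sum_cofaces id dV.
rewrite pV mulr0 => /psumr_eq0P -> //; last by rewrite dW eqxx VW.
by move=> T _; apply: pi_ge0.
Qed.

(** The factor [pi_ i V] clears the quotient in [down], so that the identity also holds where [down]
    takes its default value. *)
Lemma pi_down i g V : (i < d)%N -> \dim V = i ->
  pi_ i V * down i.+1 g V
  = (qint i.+1)^-1
    * \sum_(W | (\dim W == i.+1) && (V <= W)%VS) pi_ i.+1 W * g W.
Proof.
move=> id dV; rewrite /Defs.down.
have -> : \sum_(W in faces X i.+1 | (V <= W)%VS) pi_ i.+1 W
    = qint i.+1 * pi_ i V.
  rewrite -sum_cofaces // -[RHS](eq_bigr _ (fun W _ => mulr1 _)) -sum_faces.
  by apply: eq_bigr => W _; rewrite mulr1.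
rewrite sum_faces.
(* If [V] has weight 0, then so has every subspace of dimension [i + 1] above it, and both sides
   vanish. *)
have [p0|p0] := eqVneq (pi_ i V) 0.
  rewrite p0 mul0r big1 ?mulr0 // => W /andP[/eqP dW VW].
  by rewrite (pi_coface_eq0 id dV dW VW p0) mul0r.
have := qint_gt0 R F i; move: (qint _) => x x0.
by field; rewrite gt_eqF.
Qed.

Lemma dotE i f g : dot i f g = \sum_(V | \dim V == i) pi_ i V * f V * g V.
Proof.
have eqm V : pi_ i V * f V * g V = pi_ i V * (f V * g V) by rewrite mulrA.
rewrite /dotf !(eq_bigr _ (fun V _ => eqm V)).
rewrite [LHS](eq_bigl (fun V => (V \in faces X i) && xpredT V)).
  by rewrite sum_faces; apply: eq_bigl => V; rewrite andbT.
by move=> V; rewrite andbT.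
Qed.

Lemma expectE i f : expect X i f = dot i (fun=> 1) f.
Proof. by apply: eq_bigr => V _; rewrite mulr1. Qed.

Lemma dotC i f g : dot i f g = dot i g f.
Proof. by apply: eq_bigr => V _; rewrite mulrAC. Qed.

Lemma eq_dot i f f' g g' : (forall V, V \in faces X i -> f V = f' V) ->
  (forall V, V \in faces X i -> g V = g' V) -> dot i f g = dot i f' g'.
Proof. by move=> ff gg; apply: eq_bigr => V VX; rewrite ff ?gg. Qed.

Lemma dot_ge0 i f : (i <= d)%N -> 0 <= dot i f f.
Proof.
move=> id; apply: sumr_ge0 => V _.
by rewrite -mulrA mulr_ge0 ?pi_ge0 // -expr2 sqr_ge0.
Qed.

Lemma norm_ge0 i f : 0 <= norm i f.
Proof. exact: sqrtr_ge0. Qed.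

Lemma norm_sqr i f : (i <= d)%N -> norm i f ^+ 2 = dot i f f.
Proof. by move=> id; rewrite sqr_sqrtr ?dot_ge0. Qed.

Lemma dot_cauchy_schwarz_sqr i f g : (i <= d)%N ->
  dot i f g ^+ 2 <= dot i f f * dot i g g.
Proof. by move=> id; apply: weighted_cauchy_schwarz => V _; apply: pi_ge0. Qed.

Lemma dot_cauchy_schwarz i f g : (i <= d)%N ->
  `|dot i f g| <= norm i f * norm i g.
Proof.
move=> id; rewrite -sqrtrM ?dot_ge0 // -sqrtr_sqr.
by rewrite ler_wsqrtr // dot_cauchy_schwarz_sqr.
Qed.

(** Both sides are the same sum over pairs [V <= W], normalised by the same [[i+1]_q]. *)
Lemma dot_up i f g : (i < d)%N -> dot i.+1 (up i f) g = dot i f (down i.+1 g).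
Proof.
move=> id; rewrite !dotE.
transitivity (\sum_(V | \dim V == i) f V * (pi_ i V * down i.+1 g V));
  last first.
  by apply: eq_bigr => V _; ring.
rewrite [RHS](eq_bigr (fun V => (qint i.+1)^-1 *
  \sum_(W | (\dim W == i.+1) && (V <= W)%VS) f V * (pi_ i.+1 W * g W)));
  last first.
  move=> V /eqP dV; rewrite pi_down // -mulr_sumr; ring.
rewrite -mulr_sumr (exchange_big_dep (fun W => \dim W == i.+1)) /=; last first.
  by move=> V W _ /andP[].
rewrite mulr_sumr; apply: eq_bigr => W dW; rewrite /up qbinom_succ -mulr_suml.
rewrite [in RHS](eq_bigl (fun V => (V <= W)%VS && (\dim V == i)));
  first by ring.
by move=> V; rewrite dW /= andbC.
Qed.

Lemma up_cst i W : \dim W = i.+1 -> up i (fun=> 1 : R) W = 1.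
Proof.
move=> dW; rewrite /up card_hyperplanes // qbinom_succ mulVf //.
by rewrite gt_eqF ?qint_gt0.
Qed.

Lemma faces_dim i V : V \in faces X i -> \dim V = i.
Proof. by rewrite inE => /andP[/eqP]. Qed.

Lemma expect_down i f : (i < d)%N -> expect X i (down i.+1 f) = expect X i.+1 f.
Proof.
move=> id; rewrite !expectE -dot_up //; apply: eq_dot => // W /faces_dim.
exact: up_cst.
Qed.

Lemma expect_up i f : (i < d)%N -> expect X i.+1 (up i f) = expect X i f.
Proof.
move=> id; rewrite !expectE dotC dot_up // dotC !dotE.
apply: eq_bigr => V /eqP dV; congr (_ * _); rewrite pi_down // mulr1.
rewrite -mulr_suml mulr1 sum_cofaces // mulKf //.
by rewrite gt_eqF ?qint_gt0.
Qed.

(** [up] averages over hyperplanes, so Cauchy-Schwarz against the constant 1 gives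
    [(up i f)^2 <= up i (f^2)] pointwise, and [up] preserves expectations. *)
Lemma dot_up_le i f : (i < d)%N -> dot i.+1 (up i f) (up i f) <= dot i f f.
Proof.
move=> id.
have -> : dot i f f = expect X i (fun V => f V * f V).
  by apply: eq_bigr => V _; rewrite mulrA.
rewrite -expect_up //; apply: ler_sum => W /faces_dim dW.
rewrite -mulrA ler_wpM2l ?pi_ge0 // /up qbinom_succ.
have := @weighted_cauchy_schwarz R S (fun V => (V <= W)%VS && (\dim V == i))
  (fun=> 1) f (fun=> 1) (fun _ _ => ler01).
under eq_bigr do rewrite mulr1 mul1r.
under [X in _ <= X * _]eq_bigr do rewrite mul1r.
under [X in _ <= _ * X]eq_bigr do rewrite !mulr1.
rewrite card_hyperplanes // expr2; have := qint_gt0 R F i.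
move: (qint _) (\sum_(_ | _) _) (\sum_(_ | _) _) => x t s x0 st.
have -> : x^-1 * s * (x^-1 * s) = x^-1 ^+ 2 * (s * s) by ring.
rewrite (le_trans (ler_wpM2l _ st)) ?sqr_ge0 // le_eqVlt; apply/orP; left.
by apply/eqP; field; rewrite gt_eqF.
Qed.

Lemma norm_up_le i f : (i < d)%N -> norm i.+1 (up i f) <= norm i f.
Proof. by move=> id; rewrite ler_wsqrtr // dot_up_le. Qed.

(** The adjoint of a contraction is a contraction: [|Df|^2 = <UDf, f> <= |Df| |f|]. *)
Lemma norm_down_le i f : (i < d)%N -> norm i (down i.+1 f) <= norm i.+1 f.
Proof.
move=> id; have := norm_ge0 i (down i.+1 f); rewrite le_eqVlt.
case/orP=> [/eqP <-|N0]; first exact: norm_ge0.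
rewrite -(ler_pM2l N0) -expr2 norm_sqr 1?ltnW // -dot_up //.
apply: le_trans (ler_norm _) _.
apply: le_trans (dot_cauchy_schwarz _ _ _) _ => //.
by rewrite ler_wpM2r ?norm_ge0 ?norm_up_le.
Qed.

Lemma up_stepsD i a b f :
  up_steps i (a + b) f = up_steps (i + a) b (up_steps i a f).
Proof. by elim: b => [|b IHb]; rewrite ?addn0 // addnS /= IHb addnA. Qed.

Lemma dot_up_steps i m f g : (i + m <= d)%N ->
  dot (i + m) (up_steps i m f) g = dot i f (down_steps X i m g).
Proof.
elim: m g => [|m IHm] g; rewrite ?addn0 //= addnS => imd.
by rewrite dot_up // IHm // ltnW.
Qed.

Lemma norm_up_steps_le i m f : (i + m <= d)%N ->
  norm (i + m) (up_steps i m f) <= norm i f.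
Proof.
elim: m => [|m IHm]; rewrite ?addn0 //= addnS => imd.
by apply: le_trans (norm_up_le _ _) (IHm _); rewrite // ltnW.
Qed.

Lemma expect_down_steps i m f : (i + m <= d)%N ->
  expect X i (down_steps X i m f) = expect X (i + m) f.
Proof.
elim: m f => [|m IHm] f; rewrite ?addn0 //= addnS => imd.
by rewrite IHm ?expect_down // ltnW.
Qed.

Lemma expect1 i : (i <= d)%N -> expect X i (fun=> 1) = 1.
Proof.
move=> id; have -> : expect X i (fun=> 1) = expect X d (fun=> 1).
  (* Induction goes downwards from dimension [d], where the mass is that of the facets. Beyond
     [m = d] the truncated subtraction stays at 0. *)
  have [m ->] : exists m, i = (d - m)%N by exists (d - i)%N; rewrite subKn.
  elim: m => [|m IHm]; first by rewrite subn0.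
  have [dm|md] := leqP d m.
    by rewrite -IHm subnS (eqP (dm : (d - m == 0)%N)).
  rewrite -IHm -(subnSK md) -expect_up ?ltn_subrL ?(leq_ltn_trans _ md) //.
  rewrite !expectE; apply: eq_dot => // W /faces_dim dW.
  by rewrite up_cst.
rewrite expectE dotE; under eq_bigr do rewrite !mulr1 /Defs.pi_.
rewrite -mulr_sumr (exchange_big_dep (mem (facets X))) /=; last first.
  by move=> V W _ /andP[].
have -> : qbinom q d d = 1.
  rewrite qbinom_qfact // subnn {3}/qfact big_ord0 mulr1 divff //.
  by rewrite gt_eqF ?qfact_gt0.
rewrite invr1 mul1r -(weight_sum1 X); apply: eq_bigr => W WX.
rewrite (big_pred1 W) // => V /=; rewrite WX /=.
apply/andP/eqP => [[/eqP dV VW]|->].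
  by apply/eqP; rewrite eqEdim VW dV (facets_dim WX) leqnn.
by rewrite (facets_dim WX) eqxx subvv.
Qed.

(** * Variance, local averages and the pseudorandomness bounds *)

Lemma dotBZl i a f g h :
  dot i (fun V => f V - a * g V) h = dot i f h - a * dot i g h.
Proof.
by rewrite /dotf mulr_sumr -sumrB; apply: eq_bigr => V _; ring.
Qed.

Lemma variance_dot i f : (i <= d)%N ->
  variance X i f
  = dot i (fun V => f V - expect X i f * 1) (fun V => f V - expect X i f * 1).
Proof.
move=> id; rewrite /variance dotBZl (dotC _ f) (dotC _ (fun=> 1)) !dotBZl.
rewrite -!expectE (dotC _ f) -expectE expect1 //; ring.
Qed.

Lemma expect_in_H i h : (0 < i <= d)%N -> in_H X i h -> expect X i h = 0.
Proof.
case: i => //= i id Hh; rewrite -expect_down // expectE.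
rewrite (eq_dot (f' := fun=> 1) (g' := fun=> 0)) //.
by rewrite /dotf big1 // => V _; rewrite mulr0.
Qed.

(** Since [h] has mean 0, [g] can be centred before Cauchy-Schwarz is applied. *)
Lemma dot_in_H_sqr_le i g h : (0 < i <= d)%N -> in_H X i h ->
  dot i g h ^+ 2 <= variance X i g * dot i h h.
Proof.
move=> /[dup] id /andP[_ le_id] Hh; rewrite variance_dot //.
have -> : dot i g h = dot i (fun V => g V - expect X i g * 1) h.
  by rewrite dotBZl -expectE (expect_in_H id Hh) mulr0 subr0.
exact: dot_cauchy_schwarz_sqr.
Qed.

(** Each [up] divides by one Gaussian integer, and the remaining count is the number of flags from
    [s] to [W]. The resulting coefficient is the inverse of the Gaussian binomial of [i + m] over
    [i]. *)
Lemma up_steps_indicator i m (s : S) W : \dim s = i -> \dim W = (i + m)%N ->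
  up_steps i m (fun V => (V == s)%:R) W
  = qfact i * qfact m / qfact (i + m) * (s <= W)%VS%:R.
Proof.
move=> ds; have qf0 t : qfact t != 0 by rewrite gt_eqF ?qfact_gt0.
move=> dW0; suff -> : up_steps i m (fun V => (V == s)%:R) W
    = qfact i / qfact (i + m) * flags R s m W.
  by rewrite flagsE ?ds //; ring.
elim: m W dW0 => [|m IHm] W dW /=; first by rewrite addn0 divff ?mul1r.
rewrite addnS in dW *; rewrite ds /up qbinom_succ qfactS.
rewrite (eq_bigr (fun V => qfact i / qfact (i + m) * flags R s m V));
  last first.
  by move=> V /andP[_ /eqP dV]; rewrite IHm.
rewrite -mulr_sumr; have := qint_gt0 R F (i + m); have := qf0 (i + m)%N.
move: (qint _) (qfact (i + m)) (\sum_(_ | _) _) => x y z y0 x0.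
by field; rewrite y0 gt_eqF.
Qed.

(** Pairing with the indicator of [s] extracts the value at [s], and adjointness moves the down
    operators onto the indicator. This relates [downk] to local expectations. *)
Lemma pi_down_steps i m (s : S) f : (i + m <= d)%N -> \dim s = i ->
  pi_ i s * down_steps X i m f s = qfact i * qfact m / qfact (i + m)
    * \sum_(W in faces X (i + m) | (s <= W)%VS) pi_ (i + m) W * f W.
Proof.
move=> imd ds; transitivity (dot i (fun V => (V == s)%:R) (down_steps X i m f)).
  rewrite dotE (bigD1 s) /= ?ds // eqxx mulr1 big1 ?addr0 // => V.
  by case/andP=> _ /negPf ->; rewrite mulr0 mul0r.
rewrite -dot_up_steps // big_mkcondr mulr_sumr.
apply: eq_bigr => W /faces_dim dW.
rewrite up_steps_indicator //.
by case: (s <= W)%VS; rewrite /= ?mulr1n ?mulr0n; ring.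
Qed.

(** By [pi_down_steps], [pi_ i s * downk X k i f s] is a positive multiple of the numerator of the
    local expectation at [s], whose sign is controlled. *)
Lemma local_constant_sign_ge0 k i f (s : S) : (i <= k)%N -> (k <= d)%N ->
  local_constant_sign X k i f -> s \in faces X i ->
  0 <= pi_ i s * downk X k i f s * expect X k f.
Proof.
move=> ik kd [_ sgf] si; have ds := faces_dim si.
rewrite /downk pi_down_steps ?subnKC //.
have := sgf _ si; rewrite /local_expect.
set num := \sum_(W in _ | _) _; set den := \sum_(W in _ | _) _ => sg_num.
have c0 : 0 < qfact i * qfact (k - i) / qfact k.
  by rewrite !(mulr_gt0, invr_gt0, qfact_gt0).
have den0 : 0 <= den by apply: sumr_ge0 => W _; apply: pi_ge0.
rewrite -mulrA pmulr_rge0 //.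
(* When all weights above [s] vanish, the numerator vanishes term by term. *)
have [d0|dn0] := eqVneq den 0.
  suff -> : num = 0 by rewrite mul0r.
  rewrite /num big1 // => W Ws; move/psumr_eq0P: d0 => -> //.
    by rewrite mul0r.
  by move=> V _; apply: pi_ge0.
have [n0|nn0] := eqVneq num 0; first by rewrite n0 mul0r.
have dgt0 : 0 < den by rewrite lt_neqAle eq_sym dn0.
have /sg_num : num / den != 0 by rewrite mulf_neq0 ?invr_neq0.
rewrite sgrM sgrV (gtr0_sg dgt0) mulr1 => sgE.
by rewrite -sgr_ge0 sgrM sgE -sgrM sgr_ge0 -expr2 sqr_ge0.
Qed.

Lemma linf_variance_le i (e E : R) g : (i <= d)%N -> expect X i g = E ->
  linfnorm X i (fun V => g V - E) <= e -> variance X i g <= e ^+ 2.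
Proof.
(* The maximum in [linfnorm] starts at 0, so the hypothesis also yields [0 <= e]. *)
move=> id Eg /bigmax_leP[e0 ge]; rewrite variance_dot // Eg.
have -> : e ^+ 2 = e ^+ 2 * expect X i (fun=> 1) by rewrite expect1 // mulr1.
rewrite /expect /dotf mulr_sumr; apply: ler_sum => V VX.
rewrite -mulrA [leRHS]mulrCA ler_wpM2l ?pi_ge0 // !mulr1 -expr2.
rewrite -real_normK ?num_real //.
by rewrite ler_pXn2r ?nnegrE // ge.
Qed.

(** As [g - E] is orthogonal to constants, the variance is [<g, g - E>], at most [e] times the mean
    of [|g|], and the sign condition makes that mean [|E|]. Both sides are multiplied by [|E|] so
    that the condition enters as [|pi g E| = pi g E]. *)
Lemma linf_sign_variance_le i (e E : R) g : (i <= d)%N -> expect X i g = E ->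
  linfnorm X i (fun V => g V - E) <= e ->
  (forall s, s \in faces X i -> 0 <= pi_ i s * g s * E) -> E != 0 ->
  variance X i g <= e * `|E|.
Proof.
move=> id Eg /bigmax_leP[e0 ge] sg E0; rewrite variance_dot // Eg.
have orth : dot i (fun=> 1) (fun V => g V - E * 1) = 0.
  by rewrite dotC dotBZl (dotC _ g) -!expectE Eg expect1 // mulr1 subrr.
rewrite dotBZl orth mulr0 subr0 -(@ler_pM2l _ `|E|) ?normr_gt0 //.
have -> : `|E| * (e * `|E|) = e * E * expect X i g.
  by rewrite mulrCA -expr2 real_normK ?num_real // Eg expr2 mulrA.
rewrite /dotf /expect !mulr_sumr; apply: ler_sum => V VX; rewrite mulr1.
have -> : e * E * (pi_ i V * g V) = `|pi_ i V * g V * E| * e.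
  by rewrite ger0_norm ?sg //; ring.
move: (pi_ i V) => p; apply: le_trans (ler_norm _) _; rewrite !normrM normr_id.
have -> : `|E| * (`|p| * `|g V| * `|g V - E|)
    = `|p| * `|g V| * `|E| * `|g V - E| by ring.
by rewrite ler_wpM2l ?mulr_ge0 ?normr_ge0 // ge.
Qed.

(** * The operator norm *)

Lemma opnorm_ge0 i (A : (S -> R) -> S -> R) : (0 <= opnorm X i A)%E.
Proof.
apply: (@le_trans _ _ (norm i (A (fun=> 0)))%:E).
  by rewrite lee_fin norm_ge0.
apply: ereal_sup_ubound; exists (fun=> 0) => //=.
by rewrite /normf /dotf big1 ?sqrtr0 ?ler01 // => V _; rewrite mulr0.
Qed.

Lemma opnorm_le i (A : (S -> R) -> S -> R) (c : R) v :
  (forall t f V, A (fun V => t * f V) V = t * A f V) ->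
  (opnorm X i A <= c%:E)%E -> norm i (A v) <= c * norm i v.
Proof.
move=> homA Ac.
have normZ t f : 0 <= t -> norm i (fun V => t * f V) = t * norm i f.
  move=> t0; rewrite /normf -[in RHS](ger0_norm t0) -sqrtr_sqr.
  rewrite -sqrtrM ?sqr_ge0 //.
  by congr Num.sqrt; rewrite /dotf mulr_sumr; apply: eq_bigr => V _; ring.
have bound t : 0 <= t -> t * norm i v <= 1 -> t * norm i (A v) <= c.
  move=> t0 tv; rewrite -normZ // -lee_fin; apply: le_trans Ac.
  apply: ereal_sup_ubound; exists (fun V => t * v V) => /=.
    by rewrite normZ.
  by congr (_%:E); congr Num.sqrt; apply: eq_bigr => V _; rewrite !homA.
have [N0|N0] := eqVneq (norm i v) 0; last first.
  have Ngt0 : 0 < norm i v by rewrite lt_neqAle eq_sym N0 norm_ge0.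
  have := bound (norm i v)^-1; rewrite invr_ge0 norm_ge0 mulVf // lexx.
  by move=> /(_ isT isT); rewrite mulrC ler_pdivrMr.
(* A function of norm 0 may be nonzero on faces of weight 0. All its multiples lie in the unit ball,
   and the multiple chosen here has an image of norm [|c| + 1], exceeding [c]. *)
rewrite N0 mulr0 leNgt; apply/negP => A0.
have := bound ((`|c| + 1) / norm i (A v)).
rewrite N0 mulr0 ler01 mulfVK ?gt_eqF // divr_ge0 ?addr_ge0 ?norm_ge0 //.
by move=> /(_ isT isT); apply/negP; rewrite -ltNge ltr_pwDr ?ler_norm.
Qed.

End Operators.

(** * Approximate eigenvectors in an eposet *)

Section Eposet.
Variables (R : realType) (F : finFieldType) (n d : nat).
Variables (X : wqcomplex R F n d) (gamma : R).
Hypotheses (epX : eposet X gamma) (gamma0 : 0 <= gamma).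
Local Notation S := {vspace 'rV[F]_n}.
Local Notation q := (#|F|%:R : R).
Local Notation qint := (qint R F).
Local Notation qfact := (qfact R F).
Local Notation delta := (delta R F).
Local Notation pi_ := (pi_ X).
Local Notation dot := (dotf X).
Local Notation norm := (normf X).
Local Notation down := (Defs.down X).
Implicit Types (f g h u v : S -> R) (V W : S).

Lemma deltaE i : delta i = q * qint i / qint i.+1.
Proof.
have q1 := q_gt1 R F; have := qX_gt1 R F i.
rewrite /Defs.delta /qint; move: (q ^+ _) (q ^+ _) => x y y1.
by field; rewrite !subr_eq0 !gt_eqF.
Qed.

Lemma delta_ge0 i : 0 <= delta i.
Proof.
rewrite deltaE.
exact: divr_ge0 (mulr_ge0 (ler0n _ _) (qint_ge0 _ _ _)) (qint_ge0 _ _ _).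
Qed.

Lemma delta_sub1 i : 1 - delta i = (qint i.+1)^-1.
Proof.
have := qint_gt0 R F i; rewrite deltaE qintS; move: (q * qint i) => x x0.
by field; rewrite gt_eqF.
Qed.

Lemma delta_le1 i : delta i <= 1.
Proof. by rewrite -subr_ge0 delta_sub1 invr_ge0 qint_ge0. Qed.

(** The eposet inequality starts at [i = 1]. In dimension 0 the zero subspace is the only one, and
    [D_1 U_0] is exactly the identity. *)
Lemma dot_up_up0 u v : (0 < d)%N -> dot 1 (up 0 u) (up 0 v) = dot 0 u v.
Proof.
move=> d0; rewrite dot_up // !dotE; apply: eq_bigr => V dV0.
have /eqP dV := dV0; rewrite mulrAC pi_down // [RHS]mulrAC; congr (_ * _).
have up0 W : up 0 v W = v V.
  have V0 : V = 0%VS by apply/eqP; rewrite -dimv_eq0 dV.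
  rewrite /up qbinom_succ qint1 invr1 mul1r (big_pred1 0%VS) ?V0 // => U /=.
  by rewrite dimv_eq0 andb_idl // => /eqP ->; rewrite sub0v.
under eq_bigr do rewrite up0.
by rewrite -mulr_suml sum_cofaces // qint1 invr1 !mul1r.
Qed.

(** The eposet inequality as a bilinear form: the expression inside the absolute value is [<u, A v>]
    for the operator [A] bounded by [gamma]. *)
Lemma dot_up_up i u v : (i.+1 < d)%N ->
  `|dot i.+2 (up i.+1 u) (up i.+1 v) - (1 - delta i.+1) * dot i.+1 u v
    - delta i.+1 * dot i (down i.+1 u) (down i.+1 v)|
  <= gamma * norm i.+1 u * norm i.+1 v.
Proof.
move=> id; have id' := ltnW id; have id'' := ltnW id'.
pose A f V := down i.+2 (up i.+1 f) V - (1 - delta i.+1) * f V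
              - delta i.+1 * up i (down i.+1 f) V.
have homU t j f V : up j (fun W => t * f W) V = t * up j f V.
  by rewrite /up -mulr_sumr mulrCA.
have homD t j f V : down j (fun W => t * f W) V = t * down j f V.
  by rewrite /Defs.down mulrA mulr_sumr; under eq_bigr do rewrite mulrCA.
have homA t f V : A (fun W => t * f W) V = t * A f V.
  rewrite /A.
  have -> : up i.+1 (fun W => t * f W) = (fun W => t * up i.+1 f W).
    by apply/funext => W; rewrite homU.
  have -> : down i.+1 (fun W => t * f W) = (fun W => t * down i.+1 f W).
    by apply/funext => W; rewrite homD.
  by rewrite (homD t _ (up _ f)) (homU t _ (down _ f)); ring.
have Av : norm i.+1 (A v) <= gamma * norm i.+1 v.
  by apply: opnorm_le homA _; apply: epX.
suff -> : dot i.+2 (up i.+1 u) (up i.+1 v) - (1 - delta i.+1) * dot i.+1 u v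
    - delta i.+1 * dot i (down i.+1 u) (down i.+1 v) = dot i.+1 u (A v).
  apply: le_trans (dot_cauchy_schwarz _ _ _ id') _.
  by rewrite mulrC mulrAC ler_wpM2r ?norm_ge0.
rewrite (dotC X i.+1 u (A v)) !dotBZl dot_up // (dotC X _ u (down _ _)).
by rewrite (dotC X i) -dot_up // (dotC _ _ u).
Qed.

(* [U^(j+m)_j] carries [H^j] into an approximate eigenspace of
   [D_(j+m+1) U_(j+m)], with eigenvalue [m+1]_q / [j+m+1]_q. *)
Lemma dot_up_up_in_H j m h u : in_H X j h -> (j + m < d)%N ->
  `|dot (j + m).+1 (up (j + m) u) (up (j + m) (up_steps j m h))
    - qint m.+1 / qint (j + m).+1 * dot (j + m) u (up_steps j m h)|
  <= m.+1%:R * gamma * norm (j + m) u * norm j h.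
Proof.
move=> Hh; elim: m u => [|m IHm] u /=.
  rewrite !addn0 qint1; case: j Hh => [|j] Hh jd.
    rewrite dot_up_up0 // qint1 divr1 !mul1r subrr normr0.
    by rewrite !mulr_ge0 ?norm_ge0.
  have := dot_up_up u h jd; rewrite -delta_sub1 !mul1r.
  rewrite [X in delta _ * X](eq_dot (f' := down j.+1 u) (g' := fun=> 0)) //.
  by rewrite [X in delta _ * X]big1 ?mulr0 ?subr0 // => V _; rewrite mulr0.
rewrite addnS => jd; have jd' := ltnW jd; have jd'' := ltnW jd'.
set w := up_steps j m h; set v := up (j + m) w.
have downv : dot (j + m).+1 (up (j + m) (down (j + m).+1 u)) v
    = dot (j + m) (down (j + m).+1 u) (down (j + m).+1 v) by rewrite dot_up.
have downu : dot (j + m) (down (j + m).+1 u) w = dot (j + m).+1 u v.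
  by rewrite dotC -dot_up // dotC.
have := dot_up_up u v jd; have := IHm (down (j + m).+1 u) jd'.
rewrite -/w -/v downv downu.
move: (dot _ (up _ u) _) (dot _ u v) (dot (j + m) _ _) => P Q D.
have Nu := norm_ge0 X (j + m).+1 u; have Nh := norm_ge0 X j h.
have Nv : norm (j + m).+1 v <= norm j h.
  by apply: le_trans (norm_up_le X _ jd') (norm_up_steps_le X _ jd'').
have NDu := norm_down_le X u jd'.
have ND0 := norm_ge0 X (j + m) (down (j + m).+1 u).
(* The eigenvalues satisfy [lambda' = (1 - delta) + delta * lambda]. Since [delta <= 1], each step
   adds at most one [gamma] to the error, which therefore grows linearly in [m]. *)
have -> : qint m.+2 / qint (j + m).+2
    = 1 - delta (j + m).+1 + delta (j + m).+1 * (qint m.+1 / qint (j + m).+1).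
  rewrite delta_sub1 deltaE (qintS _ _ m.+1).
  have := qint_gt0 R F (j + m).+1; have := qint_gt0 R F (j + m).
  move: (qint (j + m).+2) (qint (j + m).+1) (qint m.+1) => x y z x0 y0.
  by field; rewrite !gt_eqF.
have := delta_ge0 (j + m).+1; have := delta_le1 (j + m).+1.
move: (delta _) (qint _ / _) => del a del1 del0 IH step.
have -> : P - (1 - del + del * a) * Q
    = (P - (1 - del) * Q - del * D) + del * (D - a * Q) by ring.
apply: le_trans (ler_normD _ _) _; rewrite normrM (ger0_norm del0).
have -> : m.+2%:R * gamma * norm (j + m).+1 u * norm j h
    = gamma * norm (j + m).+1 u * norm j h
      + m.+1%:R * gamma * norm (j + m).+1 u * norm j h.
  by rewrite -[m.+2%:R]natr1; ring.
apply: lerD.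
  by apply: le_trans step _; rewrite ler_wpM2l // mulr_ge0.
apply: (@le_trans _ _ `|D - a * Q|); first by rewrite ler_piMl.
by apply: le_trans IH _; rewrite ler_wpM2r // ler_wpM2l // mulr_ge0.
Qed.

(** The eigenvalues multiply to the inverse of the Gaussian binomial of [j + m] over [j]. They are
    at most 1, so earlier errors do not grow, and [1 + ... + m <= m^2]. *)
Lemma dot_up_steps_in_H j m g h : in_H X j h -> (j + m <= d)%N ->
  `|dot (j + m) (up_steps j m g) (up_steps j m h)
    - qfact m * qfact j / qfact (j + m) * dot j g h|
  <= m%:R ^+ 2 * gamma * norm j g * norm j h.
Proof.
move=> Hh; elim: m => [|m IHm].
  rewrite addn0 {1}/qfact big_ord0 mul1r divff ?gt_eqF ?qfact_gt0 //=.
  by rewrite mul1r subrr normr0 expr0n /= !mul0r.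
rewrite addnS => jd; have jd' := ltnW jd.
have := IHm jd'; have := dot_up_up_in_H (up_steps j m g) Hh jd.
rewrite /= !qfactS.
have : 0 <= qint m.+1 / qint (j + m).+1 <= 1.
  rewrite divr_ge0 ?qint_ge0 //= ler_pdivrMr ?qint_gt0 // mul1r.
  rewrite ler_pM2r ?invr_gt0 ?subr_gt0 ?q_gt1 // lerD2r.
  by rewrite ler_eXn2l ?q_gt1 // ltnS leq_addl.
have := norm_up_steps_le X g jd'; have Ng := norm_ge0 X j g.
have Nh := norm_ge0 X j h.
have -> : qfact m * qint m.+1 * qfact j / (qfact (j + m) * qint (j + m).+1)
    = qint m.+1 / qint (j + m).+1 * (qfact m * qfact j / qfact (j + m)).
  have := qint_gt0 R F (j + m); have := qfact_gt0 R F (j + m).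
  move: (qint (j + m).+1) (qint m.+1) (qfact (j + m)) => x y z z0 x0.
  by field; rewrite !gt_eqF.
move: (qint _ / _) (_ / qfact _) (dot _ (up _ _) _) (dot _ (up_steps _ _ _) _).
move=> a b P Q; move: (dot _ _ _) (norm (j + m) _) => G Nu NuN /andP[a0 a1].
move=> step IH.
have -> : P - a * b * G = (P - a * Q) + a * (Q - b * G) by ring.
apply: le_trans (ler_normD _ _) _; rewrite normrM (ger0_norm a0).
have step' : `|P - a * Q| <= m.+1%:R * gamma * norm j g * norm j h.
  apply: le_trans step _; rewrite ler_wpM2r // ler_wpM2l // mulr_ge0 //.
have IH' : a * `|Q - b * G| <= m%:R ^+ 2 * gamma * norm j g * norm j h.
  by apply: le_trans IH; rewrite ler_piMl ?normr_ge0.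
apply: le_trans (lerD step' IH') _.
rewrite -!mulrDl !ler_wpM2r //.
rewrite -natr1; have := ler0n R m; nra.
Qed.

End Eposet.

(** A Gershgorin-type estimate: [N i * N j <= (N i ^+ 2 + N j ^+ 2) / 2] bounds the total error by
    [eps * (k + 1)] times the sum of the [N i ^+ 2], which uses up at most half of [beta]. *)
Lemma almost_diagonal_form (R : realType) (k : nat) (N lam : 'I_k.+1 -> R)
    (G : 'I_k.+1 -> 'I_k.+1 -> R) (eps beta : R) :
  0 <= eps -> eps * k.+1%:R <= beta / 2 ->
  (forall i, 0 <= N i) -> (forall i, beta <= lam i) ->
  (forall i j, `|G i j - (i == j)%:R * (lam i * N i ^+ 2)|
               <= eps * N i * N j) ->
  (\sum_i N i ^+ 2) * (beta / 2) <= \sum_i \sum_j G i j /\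
  forall i, `|\sum_j G j i - lam i * N i ^+ 2|
            <= eps * k.+1%:R * \sum_j N j ^+ 2.
Proof.
move=> eps0 small N0 lamb GN; set M := \sum_i N i ^+ 2.
have sumc (c : R) : \sum_(i < k.+1) c = k.+1%:R * c.
  by rewrite sumr_const card_ord mulr_natl.
have NM i : N i ^+ 2 <= M.
  by rewrite /M (bigD1 i) //= lerDl sumr_ge0 // => j _; rewrite sqr_ge0.
have M0 : 0 <= M by apply: sumr_ge0 => i _; rewrite sqr_ge0.
have amgm i j : N i * N j <= (N i ^+ 2 + N j ^+ 2) / 2.
  by have := sqr_ge0 (N i - N j); nra.
have diag i : \sum_j (j == i)%:R * (lam j * N j ^+ 2) = lam i * N i ^+ 2.
  rewrite (bigD1 i) //= eqxx mul1r big1 ?addr0 // => j /negPf ->.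
  by rewrite mul0r.
split; last first.
  move=> i; rewrite -diag -sumrB; apply: le_trans (ler_norm_sum _ _ _) _.
  rewrite -mulrA -sumc mulr_sumr; apply: ler_sum => j _.
  apply: le_trans (GN j i) _; rewrite -mulrA ler_wpM2l //.
  by have := amgm j i; have := NM i; have := NM j; lra.
have Glow i : lam i * N i ^+ 2 - eps / 2 * (k.+1%:R * N i ^+ 2 + M)
    <= \sum_j G j i.
  rewrite -diag -sumc -big_split /= mulr_sumr -sumrB; apply: ler_sum => j _.
  have := GN j i; rewrite ler_norml => /andP[].
  have := amgm j i; move: (N i * N j) (N j * N i) => *.
  have : eps * (N j * N i) <= eps * ((N j ^+ 2 + N i ^+ 2) / 2).
    by rewrite ler_wpM2l.
  lra.
rewrite exchange_big /=.
apply: le_trans (ler_sum _ (fun i _ => Glow i)).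
rewrite sumrB -mulr_sumr big_split /= -mulr_sumr sumc -/M.
have : beta * M <= \sum_i lam i * N i ^+ 2.
  by rewrite mulr_sumr; apply: ler_sum => i _; rewrite ler_wpM2r ?sqr_ge0.
have : eps * k.+1%:R * M <= beta / 2 * M by rewrite ler_wpM2r.
lra.
Qed.

(** * The Gram matrix of the components, and the bound on one component *)

Section Decomposition.
Variables (R : realType) (F : finFieldType) (n d k : nat).
Variables (X : wqcomplex R F n d) (gamma : R).
Hypotheses (epX : eposet X gamma) (gamma0 : 0 <= gamma) (kd : (k <= d)%N).
Variable h : nat -> {vspace 'rV[F]_n} -> R.
Hypothesis Hh : forall j, (j <= k)%N -> in_H X j (h j).
Local Notation q := (#|F|%:R : R).
Local Notation dot := (dotf X).
Local Notation norm := (normf X).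

(** For [a < b], both vectors are images under [U^k_b], of [U^b_a h_a] and of [h_b]. These are
    orthogonal because [D_b h_b = 0], and [U^k_b] preserves this up to the error of
    [dot_up_steps_in_H]. *)
Lemma gram_bound i j : (i <= k)%N -> (j <= k)%N ->
  `|dot k (upk k i (h i)) (upk k j (h j))
    - (i == j)%:R * ((qbinom q k i)^-1 * norm i (h i) ^+ 2)|
  <= k%:R ^+ 2 * gamma * norm i (h i) * norm j (h j).
Proof.
have lt_case a b : (a < b)%N -> (b <= k)%N ->
    `|dot k (upk k a (h a)) (upk k b (h b))|
    <= k%:R ^+ 2 * gamma * norm a (h a) * norm b (h b).
  move=> ab bk; have ak := ltnW (leq_trans ab bk).
  have -> : upk k a (h a) = up_steps b (k - b) (up_steps a (b - a) (h a)).
    rewrite /upk (_ : k - a = (b - a) + (k - b))%N; last by lia.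
    by rewrite up_stepsD subnKC // ltnW.
  have bd := leq_trans bk kd.
  have := @dot_up_steps_in_H _ _ _ _ _ _ epX gamma0 b (k - b) 
    (up_steps a (b - a) (h a)) (h b) (Hh bk).
  rewrite subnKC // => /(_ kd).
  have -> : dot b (up_steps a (b - a) (h a)) (h b) = 0.
    case: b ab bk bd => // b ab bk bd.
    rewrite subSn //= subnKC // dot_up //.
    have Hb := Hh bk.
    rewrite (eq_dot (f' := up_steps a (b - a) (h a)) (g' := fun=> 0)) //.
    by rewrite /dotf big1 // => V _; rewrite mulr0.
  rewrite mulr0 subr0 => /le_trans; apply.
  have := norm_up_steps_le X (m := b - a) (h a) (i := a).
  rewrite subnKC ?(ltnW ab) // => /(_ bd).
  have Na := norm_ge0 X a (h a); have Nb := norm_ge0 X b (h b).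
  have Nc := norm_ge0 X b (up_steps a (b - a) (h a)) => le_c.
  rewrite ler_wpM2r // ler_pM // ?mulr_ge0 ?exprn_ge0 ?ler0n //.
  by rewrite ler_wpM2r // ler_pXn2r ?nnegrE ?ler0n // ler_nat leq_subr.
move=> ik jk; case: (ltngtP i j) => [ij|ij|<-].
- by rewrite mul0r subr0 lt_case.
- by rewrite mul0r subr0 dotC (le_trans (lt_case _ _ ij ik)) // mulrAC.
rewrite mul1r norm_sqr ?(leq_trans ik kd) //.
have := @dot_up_steps_in_H _ _ _ _ _ _ epX gamma0 i (k - i) (h i) (h i) (Hh ik).
rewrite subnKC // => /(_ kd); rewrite qbinom_qfact // invf_div.
rewrite (mulrC (qfact _ _ i)) => /le_trans; apply.
rewrite !ler_wpM2r ?norm_ge0 //.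
by rewrite ler_pXn2r ?nnegrE ?ler0n // ler_nat leq_subr.
Qed.

Variables (f : {vspace 'rV[F]_n} -> R) (fs : nat -> {vspace 'rV[F]_n} -> R).
Hypothesis fsE : forall j, (j <= k)%N ->
  forall W, W \in faces X k -> fs j W = upk k j (h j) W.
Hypothesis fE : forall W, W \in faces X k -> f W = \sum_(j < k.+1) fs j W.
Hypothesis small_gamma :
  2 * k.+1%:R * k%:R ^+ 2 * q ^+ (k ^ 2) * gamma <= 1.

Lemma dot_decomposition g :
  dot k f g = \sum_(j < k.+1) dot k (upk k j (h j)) g.
Proof.
rewrite /dotf exchange_big /=; apply: eq_bigr => V VX; rewrite fE //.
rewrite mulr_sumr mulr_suml; apply: eq_bigr => j _.
by rewrite fsE // -ltnS.
Qed.

Lemma dot_component_le i : (0 < i <= k)%N ->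
  `|dot k f (fs i)|
  <= qbinom q k i * variance X i (downk X k i f)
     + 2 * k.+1%:R * k%:R ^+ 2 * q ^+ (k ^ 2) * gamma * norm k f ^+ 2.
Proof.
move=> /andP[i0 ik]; have id := leq_trans ik kd.
have q1 := q_gt1 R F; have q0 : 0 < q by apply: lt_trans q1.
pose eps : R := k%:R ^+ 2 * gamma; pose B : R := q ^+ (k ^ 2).
have B0 : 0 < B by rewrite exprn_gt0.
have eps0 : 0 <= eps by rewrite mulr_ge0 ?exprn_ge0 ?ler0n.
(* [B^-1 = q^(-k^2)] bounds all the diagonal entries [lam] from below, by [qbinom_le]; [small_gamma]
   is this condition with the denominators cleared. *)
have small : eps * k.+1%:R <= B^-1 / 2.
  rewrite -invfM -[leRHS]div1r ler_pdivlMr ?mulr_gt0 //.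
  apply: le_trans small_gamma; rewrite le_eqVlt; apply/orP; left; apply/eqP.
  by rewrite /eps /B; ring.
pose N (j : 'I_k.+1) := norm j (h j).
pose lam (j : 'I_k.+1) := (qbinom q k j)^-1.
have le_k (j : 'I_k.+1) : (j <= k)%N by rewrite -ltnS.
pose G (j l : 'I_k.+1) := dot k (upk k j (h j)) (upk k l (h l)).
have [] := @almost_diagonal_form R k N lam G eps B^-1 eps0 small.
- by move=> j; apply: norm_ge0.
- move=> j; rewrite lef_pV2 ?posrE ?qbinom_gt0 ?le_k //; exact: qbinom_le.
- by move=> j l; rewrite -val_eqE; apply: gram_bound.
set M := \sum_j N j ^+ 2 => lowM /(_ (Ordinal (ik : (i < k.+1)%N))).
have -> : \sum_j G j (Ordinal (ik : (i < k.+1)%N)) = dot k f (fs i).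
  rewrite dot_decomposition; apply: eq_bigr => j _; apply: eq_dot => // W WX.
  by rewrite fsE.
rewrite /N /lam /=; set x := dot k f (fs i).
(* The components cannot cancel much, so [M] is at most [2 * B] times the squared norm of [f]. This
   turns the error in [M] into one in [f]. *)
have lowf : M * (B^-1 / 2) <= norm k f ^+ 2.
  rewrite norm_sqr // dot_decomposition; apply: le_trans lowM _.
  rewrite le_eqVlt; apply/orP; left; apply/eqP; apply: eq_bigr => j _.
  by rewrite dotC dot_decomposition; apply: eq_bigr => l _; rewrite dotC.
have MB : eps * k.+1%:R * M
    <= 2 * k.+1%:R * k%:R ^+ 2 * B * gamma * norm k f ^+ 2.
  have -> : eps * k.+1%:R * M
      = 2 * k.+1%:R * k%:R ^+ 2 * B * gamma * (M * (B^-1 / 2)).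
    by rewrite /eps; field; rewrite gt_eqF.
  by rewrite ler_wpM2l // !mulr_ge0 ?exprn_ge0 ?ler0n // ltW.
move=> near; rewrite -/B.
have V0 : 0 <= variance X i (downk X k i f) by rewrite variance_dot // dot_ge0.
have xV : x ^+ 2 <= variance X i (downk X k i f) * norm i (h i) ^+ 2.
  rewrite norm_sqr // /x.
  have -> : dot k f (fs i) = dot i (downk X k i f) (h i).
    rewrite [RHS]dotC /downk -dot_up_steps ?subnKC // dotC.
    by apply: eq_dot => // W WX; rewrite fsE.
  by apply: dot_in_H_sqr_le; rewrite ?i0 //; apply: Hh.
move: near MB xV V0 (qbinom_gt0 R F ik).
move: (qbinom _ _ _) (variance _ _ _) (norm i (h i) ^+ 2) (eps * _ * M).
move: (2 * _ * _ * _ * _ * _).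
move=> e' b V N2 e near ee xV V0 b0; apply: le_trans (lerD (lexx _) ee).
have e0 : 0 <= e by apply: le_trans near; apply: normr_ge0.
have N2x : N2 <= b * (`|x| + e).
  rewrite -ler_pdivrMl //; have := ler_norm x; move: near.
  by rewrite ler_norml => /andP[]; lra.
(* It remains to solve [|x|^2 <= b V (|x| + e)]. If [|x| > b V + e], then
   [|x|^2 > b V |x| + e |x| >= b V (|x| + e)], a contradiction. *)
rewrite leNgt; apply/negP => xbig.
have x0 : 0 < `|x|.
  by apply: le_lt_trans xbig; rewrite addr_ge0 // mulr_ge0 // ltW.
have xx : `|x| * `|x| <= V * b * (`|x| + e).
  rewrite -expr2 real_normK ?num_real // (le_trans xV) // -mulrA ler_wpM2l //.
have Vb0 : 0 <= V * b by rewrite mulr_ge0 // ltW.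
have : (b * V + e) * `|x| < `|x| * `|x| by rewrite ltr_pM2r.
have : b * V * e <= e * `|x|.
  by rewrite mulrC ler_wpM2l // ltW // (le_lt_trans _ xbig) // lerDl.
by move: xx; rewrite (mulrC V b) !mulrDr !mulrDl; lra.
Qed.

End Decomposition.

(** Source of the exponent 5: the factors 2, [k + 1], [k], [k] and [Q ^ (k ^ 2)] are each at most
    [Q ^ (k ^ 2)] when [k > 0]; for [k = 0] the left side is 0. *)
Lemma constant_le (Q k : nat) : (1 < Q)%N ->
  (2 * k.+1 * k ^ 2 * Q ^ (k ^ 2) <= Q ^ (5 * k ^ 2))%N.
Proof.
case: k => [|k] Q1; first by rewrite exp0n // muln0.
set m := k.+1; have kQ : (m < Q ^ (m ^ 2))%N.
  by apply: leq_trans (ltn_expl m Q1) _; rewrite leq_exp2l // -mulnn leq_pmulr.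
have Q2 : (2 <= Q ^ (m ^ 2))%N.
  by apply: leq_trans kQ.
have -> : (5 * m ^ 2 = m ^ 2 + m ^ 2 + (m ^ 2 + m ^ 2) + m ^ 2)%N by lia.
rewrite !expnD leq_mul // leq_mul //; first exact: leq_mul.
by rewrite -mulnn leq_mul // ltnW.
Qed.

Theorem theorem7p7 (R : realType) :
  exists c0 C : R, 0 < c0 /\
  forall (F : finFieldType) (k : nat),
  exists c : R, 0 <= c <= #|F|%:R `^ (C * k%:R ^+ 2) /\
  forall (n d : nat) (X : wqcomplex R F n d) (gamma : R),
    eposet X gamma ->
    gamma <= #|F|%:R `^ (- c0 * k%:R ^+ 2) ->
    (k < d)%N ->
  forall (f : {vspace 'rV[F]_n} -> R) (fs : nat -> {vspace 'rV[F]_n} -> R),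
    level_set_decomposition X k f fs ->
  forall (l : nat) (eps : nat -> R), (l <= k)%N ->
    (linf_pseudorandom X k l eps f ->
     forall i : nat, (1 <= i <= l)%N ->
       `|dotf X k f (fs i)|
         <= (qbinom #|F|%:R k i + c * gamma) * eps i ^+ 2
            + c * gamma * normf X k f ^+ 2) /\
    (forall i : nat, (1 <= i <= l)%N ->
       (linf_pseudorandom X k l eps f /\ local_constant_sign X k i f) \/
       l2_pseudorandom X k l eps f ->
       `|dotf X k f (fs i)|
         <= qbinom #|F|%:R k i * eps i * `|expect X k f|
            + c * gamma * normf X k f ^+ 2).
Proof.
(* The bound [c <= q^(5 k^2)] serves twice: it is the required size of [c], and with
   [gamma <= q^(-5 k^2)] it gives [c * gamma <= 1], the smallness condition of
   [dot_component_le]. *)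
exists 5, 5; split=> // F k.
have powE : (#|F|%:R : R) `^ (5 * k%:R ^+ 2) = #|F|%:R ^+ (5 * k ^ 2).
  by rewrite -[RHS]powR_mulrn // natrM natrX.
pose c : R := 2 * k.+1%:R * k%:R ^+ 2 * #|F|%:R ^+ (k ^ 2).
have c_ge0 : 0 <= c by rewrite !mulr_ge0 ?exprn_ge0.
have c_le : c <= #|F|%:R ^+ (5 * k ^ 2).
  by rewrite /c -!(natrX, natrM) ler_nat constant_le // finNzRing_gt1.
exists c; rewrite powE c_ge0 c_le; split=> // n d X gamma epX.
rewrite mulNr powRN powE => gamma_le kd f fs [fsV fE] l eps lk.
have q0 : 0 < (#|F|%:R : R) by rewrite (lt_trans _ (q_gt1 R F)).
have cgamma_le1 : c * gamma <= 1.
  apply: le_trans (ler_wpM2l c_ge0 gamma_le) _.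
  by rewrite ler_pdivrMr ?exprn_gt0 // mul1r.
have kd' := ltnW kd.
have [h hP] : exists h : nat -> {vspace 'rV[F]_n} -> R, forall j, (j <= k)%N ->
    in_H X j (h j) /\ forall W, W \in faces X k -> fs j W = upk k j (h j) W.
  have /choice[h hP] : forall j, exists hj, (j <= k)%N ->
      in_H X j hj /\ forall W, W \in faces X k -> fs j W = upk k j hj W.
    move=> j; have [jk|_] := leqP j k; last by exists (fs j).
    by have [hj ? ?] := fsV j jk; exists hj.
  by exists h.
have main i : (1 <= i <= l)%N -> `|dotf X k f (fs i)|
    <= qbinom #|F|%:R k i * variance X i (downk X k i f)
       + c * gamma * normf X k f ^+ 2 /\ 0 <= gamma.
  move=> /andP[i0 il]; have ik := leq_trans il lk.
  (* Nonnegativity of [gamma] comes from the eposet inequality at level 1, available because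
     [1 <= i <= k < d]. *)
  have gamma0 : 0 <= gamma.
    have d1 : (1 <= 1 < d)%N by rewrite (leq_ltn_trans (leq_trans i0 ik) kd).
    rewrite -lee_fin; apply: le_trans (epX 1%N d1).
    exact: opnorm_ge0.
  split=> //; apply: (@dot_component_le _ _ _ _ _ _ gamma epX gamma0 kd' h) =>
    //.
  - by move=> j /hP[].
  - by move=> j /hP[].
  by rewrite i0 ik.
have expect_downk i : (i <= k)%N -> expect X i (downk X k i f) = expect X k f.
  by move=> ik; rewrite /downk expect_down_steps subnKC.
split=> [psr i il|i il hyp].
  have [+ gamma0] := main i il => /le_trans; apply; rewrite lerD2r.
  have ik : (i <= k)%N by case/andP: il => _ /leq_trans; apply.
  rewrite mulrDl; apply: ler_wpDr.
    exact: mulr_ge0 (mulr_ge0 c_ge0 gamma0) (sqr_ge0 _).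
  apply: ler_wpM2l; first by rewrite ltW // qbinom_gt0.
  exact: linf_variance_le (leq_trans ik kd') (expect_downk i ik) (psr i il).
have [+ gamma0] := main i il => /le_trans; apply; rewrite lerD2r -mulrA.
have ik : (i <= k)%N by case/andP: il => _ /leq_trans; apply.
apply: ler_wpM2l; first by rewrite ltW // qbinom_gt0.
case: hyp => [[psr sgf]|]; last by apply.
apply: (linf_sign_variance_le (leq_trans ik kd')
  (expect_downk i ik) (psr i il)).
  2: exact: (proj1 sgf).
by move=> s si; apply: local_constant_sign_ge0.
Qed.
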